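(* For any (classical) knot $K$, $$\mathrm{u}(K)\le \frac{\mathrm{tr}(K)}{2}.$$
   Context: A shadow is a planar knot diagram in which the over/under information of all crossings is undetermined; such undetermined crossings are called precrossings. Resolving a precrossing means assigning over/under information to it. The shadow of a diagram $D$ is obtained by forgetting all crossing information. The trivializing number $\mathrm{tr}(S)$ of a shadow $S$ is the minimum number of precrossings which must be (suitably) resolved so that the result is necessarily unknotted, i.e. every way of resolving the remaining precrossings gives a diagram of the unknot. For a knot $K$, $\mathrm{tr}(K)=\min_{S}\mathrm{tr}(S)$, where $S$ ranges over the shadows of all diagrams of $K$. The unknotting number $\mathrm{u}(D)$ of a diagram $D$ is the minimum number of crossings of $D$ that must be switched so that the resulting diagram is a diagram of the unknot, and $\mathrm{u}(K)=\min_D \mathrm{u}(D)$ over all diagrams $D$ of $K$. *)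

(* Defs.v *)
From mathcomp Require Import all_boot all_order all_algebra finmap.
From mathcomp Require Import all_classical all_reals all_analysis.

Set Implicit Arguments.
Unset Strict Implicit.
Unset Printing Implicit Defensive.

Import Order.TTheory GRing.Theory Num.Theory.
Import numFieldNormedType.Exports.

Local Open Scope classical_set_scope.
Local Open Scope ring_scope.

Notation plane R := (R * R)%type (only parsing).
(* 3-space is plane * line, so that [fst] is the vertical projection and [snd]
   the height. *)
Notation space3 R := (R * R * R)%type (only parsing).

(** * Closed curves and knots *)

(* C^oo closed curves with nowhere vanishing velocity.  The circle is R/Z: each
   of its points has exactly one representative in [0, 1[. *)
Definition regular_closed_curve (R : realType) (V : normedModType R)
    (c : R -> V) : Prop :=
  [/\ forall (n : nat) (t : R), derivable (derive1n n c) t 1,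
      forall t : R, derive1 c t != 0
    & forall t : R, c (t + 1) = c t].

Definition knot_parametrization (R : realType) (k : R -> space3 R) : Prop :=
  regular_closed_curve k /\ {in `[0, 1[ &, injective k}.

(* Knots are unoriented: they are the images of the smooth embeddings of the
   circle. *)
Definition is_knot (R : realType) (K : set (space3 R)) : Prop :=
  exists2 k : R -> space3 R, knot_parametrization k & range k = K.

Definition homeomorphism (T U : topologicalType) (f : T -> U) : Prop :=
  exists g : U -> T,
    [/\ cancel f g, cancel g f, continuous f & continuous g].

Definition ambient_isotopic (R : realType) (A B : set (space3 R)) : Prop :=
  exists H : R -> space3 R -> space3 R,
    [/\ {within `[0, 1] `*` setT,
          continuous (fun tp : R * space3 R => H tp.1 tp.2)},
        H 0 = id,
        forall t, t \in `[0, 1] -> homeomorphism (H t)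
      & H 1 @` A = B].

Definition unknot (R : realType) : set (space3 R) :=
  [set p | p.1.1 ^+ 2 + p.1.2 ^+ 2 = 1 /\ p.2 = 0].
Arguments unknot {R}.

(** * Shadows and diagrams *)

(* A double point of the curve is identified with its two parameters, listed in
   increasing order. *)
Definition double_points (R : realType) (c : R -> plane R) : set (R * R) :=
  [set st | [/\ 0 <= st.1, st.1 < st.2, st.2 < 1 & c st.1 = c st.2]].

Definition independent (R : realType) (u v : plane R) : Prop :=
  u.1 * v.2 - u.2 * v.1 != 0.

Record shadow (R : realType) := Shadow {
  shadow_curve :> R -> plane R;
  _ : regular_closed_curve shadow_curve;
  _ : finite_set (double_points shadow_curve);
  (* no triple points *)
  _ : forall r s t : R, r \in `[0, 1[ -> s \in `[0, 1[ -> t \in `[0, 1[ ->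
      shadow_curve r = shadow_curve s -> shadow_curve s = shadow_curve t ->
      [\/ r = s, s = t | r = t];
  (* transversality *)
  _ : forall st, double_points shadow_curve st ->
      independent (derive1 shadow_curve st.1) (derive1 shadow_curve st.2) }.

Definition precrossings (R : realType) (S : shadow R) : set (R * R) :=
  double_points S.

(* At a precrossing (s, t), the value [true] means that the strand at parameter
   s is over the strand at parameter t, and [false] the opposite.  The values
   elsewhere are irrelevant. *)
Definition resolution (R : realType) := R * R -> bool.

Record diagram (R : realType) := Diagram {
  shadow_of :> shadow R;
  over_info : resolution R }.

Definition diagram_of (R : realType) (D : diagram R) (K : set (space3 R)) :
    Prop :=
  exists k : R -> space3 R,
    [/\ knot_parametrization k,
        forall t : R, (k t).1 = D t,
        forall st, precrossings D st ->
          if over_info D st then (k st.2).2 < (k st.1).2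
          else (k st.1).2 < (k st.2).2
      & ambient_isotopic (range k) K].

Definition switch (R : realType) (D : diagram R) (P : {fset R * R}) :
    diagram R :=
  Diagram D (fun st => if st \in P then ~~ over_info D st else over_info D st).

(** * Unknotting and trivializing numbers *)

(* The minimum of a set of natural numbers, with the convention that it is +oo
   for the empty set. *)
Definition min_card (R : realType) (T : choiceType) (X : set {fset T}) :
    \bar R :=
  ereal_inf [set (#|` P |)%:R%:E | P in X].

Definition diagram_unknotting_number (R : realType) (D : diagram R) : \bar R :=
  min_card R [set P : {fset R * R} |
    [set` P] `<=` precrossings D /\ diagram_of (switch D P) unknot].

Definition unknotting_number (R : realType) (K : set (space3 R)) : \bar R :=
  ereal_inf
    [set diagram_unknotting_number D | D in [set D | diagram_of D K]].

Definition necessarily_unknotted (R : realType) (S : shadow R)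
    (P : {fset R * R}) (r : resolution R) : Prop :=
  forall o : resolution R, {in P, o =1 r} -> diagram_of (Diagram S o) unknot.

Definition shadow_trivializing_number (R : realType) (S : shadow R) : \bar R :=
  min_card R [set P : {fset R * R} |
    [set` P] `<=` precrossings S /\ exists r, necessarily_unknotted S P r].

Definition trivializing_number (R : realType) (K : set (space3 R)) : \bar R :=
  ereal_inf [set shadow_trivializing_number (shadow_of D) |
             D in [set D | diagram_of D K]].

(* Main.v *)
Require Import Defs.
From HB Require Import structures.
From mathcomp Require Import all_boot all_order all_algebra finmap.
From mathcomp Require Import all_classical all_reals all_analysis.

(** If resolving a set P of n precrossings by r forces the unknot, then so does
    resolving P by the opposite of r, since the mirror image of the unknot is
    the unknot.  A diagram of K with the given shadow disagrees with one of these
    two resolutions at no more than n / 2 points of P; switching those crossings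
    unknots it. *)

Set Implicit Arguments.
Unset Strict Implicit.
Unset Printing Implicit Defensive.

Import Order.TTheory GRing.Theory Num.Theory.
Import numFieldNormedType.Exports.

Local Open Scope classical_set_scope.
Local Open Scope ring_scope.

Section ContinuousLinear.
Variables (R : realType) (V W : normedModType R) (L : {linear V -> W}).
Hypothesis cL : continuous L.

(** [L] commutes with difference quotients by linearity and with their limit by continuity. Stated
    as a convergence, this yields both derivability of [L \o f] and the value of its derivative. *)
Lemma cvg_difference_quotient_linear (f : R -> V) (t : R) :
  derivable f t 1 ->
  h^-1 *: (((L \o f) \o shift t) (h *: 1) - (L \o f) t) @[h --> 0^']
    --> L ('D_1 f t).
Proof.
move=> df; pose q h := h^-1 *: ((f \o shift t) (h *: 1) - f t).
have -> : (fun h : R => h^-1 *: (((L \o f) \o shift t) (h *: 1) - (L \o f) t))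
    = L \o q.
  by apply/funext => h; rewrite /= -linearB -linearZ_LR.
by apply: cvg_comp; [exact: df | exact: cL].
Qed.

Lemma derivable_linear_comp (f : R -> V) (t : R) :
  derivable f t 1 -> derivable (L \o f) t 1.
Proof. by move=> /cvg_difference_quotient_linear; exact: cvgP. Qed.

Lemma derive1_linear_comp (f : R -> V) (t : R) :
  derivable f t 1 -> derive1 (L \o f) t = L (derive1 f t).
Proof.
move=> df; rewrite !derive1E; apply/cvg_lim => //.
exact: cvg_difference_quotient_linear.
Qed.

Lemma derive1n_linear_comp (f : R -> V) (n : nat) :
  (forall m t, derivable (derive1n m f) t 1) ->
  derive1n n (L \o f) = L \o derive1n n f.
Proof.
move=> df; elim: n => [//|n IHn]; rewrite !derive1nS IHn.
by apply/funext => t; rewrite derive1_linear_comp.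
Qed.

(** Injectivity of [L] is what keeps the velocity from vanishing. *)
Lemma regular_closed_curve_linear_comp (c : R -> V) :
  injective L -> regular_closed_curve c -> regular_closed_curve (L \o c).
Proof.
move=> injL [dc nzc pc]; split=> [n t|t|t].
- by rewrite derive1n_linear_comp //; exact: derivable_linear_comp.
- rewrite derive1_linear_comp; last exact: (dc 0%N).
  by rewrite -(linear0 L) (inj_eq injL).
- by rewrite /= pc.
Qed.

End ContinuousLinear.

Section Mirror.
Variable R : realType.

Definition mirror (p : space3 R) : space3 R := (p.1, - p.2).

Lemma mirror_is_linear : linear mirror.
Proof.
move=> a u v; rewrite /mirror /=; congr pair.
by rewrite opprD -scalerN.
Qed.

HB.instance Definition _ :=
  GRing.isLinear.Build R (space3 R) (space3 R) *:%R mirror mirror_is_linear.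

Lemma mirrorK : involutive mirror.
Proof. by move=> [p z]; rewrite /mirror /= opprK. Qed.

Lemma mirror_continuous : continuous mirror.
Proof.
move=> p; apply: (@cvg_pair _ _ _ _ (nbhs p.1) (nbhs (- p.2))).
  exact: cvg_fst.
by apply: continuous_comp; [exact: cvg_snd | exact: opp_continuous].
Qed.

Lemma mirror_unknot : mirror @` unknot = unknot.
Proof.
apply/seteqP; split=> [_ [p [Cp zp] <-]|p [Cp zp]].
  by split=> //=; rewrite zp oppr0.
exists (mirror p); last exact: mirrorK.
by split=> //=; rewrite zp oppr0.
Qed.

Lemma homeomorphism_mirror_conj (f : space3 R -> space3 R) :
  homeomorphism f -> homeomorphism (mirror \o f \o mirror).
Proof.
move=> [g [fK gK cf cg]]; exists (mirror \o g \o mirror); split.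
- by move=> p; rewrite /= mirrorK fK mirrorK.
- by move=> p; rewrite /= mirrorK gK mirrorK.
- move=> p; apply: continuous_comp; first exact: mirror_continuous.
  by apply: continuous_comp; [exact: cf | exact: mirror_continuous].
- move=> p; apply: continuous_comp; first exact: mirror_continuous.
  by apply: continuous_comp; [exact: cg | exact: mirror_continuous].
Qed.

(** The isotopy is conjugated by [mirror], rather than followed by it, so that it still starts at
    the identity. *)
Lemma ambient_isotopic_mirror (A B : set (space3 R)) :
  ambient_isotopic A B -> ambient_isotopic (mirror @` A) (mirror @` B).
Proof.
move=> [H [cH H0 hH <-]]; exists (fun t => mirror \o H t \o mirror); split.
- apply/subspace_continuousP => -[t p] [tI _].
  pose F (tp : R * space3 R) := H tp.1 tp.2.
  pose m (tp : R * space3 R) := (tp.1, mirror tp.2).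
  have cm : continuous m.
    move=> tp; apply: (@cvg_pair _ _ _ _ (nbhs tp.1) (nbhs (mirror tp.2))).
      exact: cvg_fst.
    by apply: continuous_comp; [exact: cvg_snd | exact: mirror_continuous].
  have cF : F @ within (`[0, 1] `*` setT) (nbhs (m (t, p))) --> F (m (t, p)).
    by move/subspace_continuousP : cH; apply.
  apply: (@cvg_comp _ _ _ (F \o m) mirror); last exact: mirror_continuous.
  (* Since [m] keeps the time coordinate, it maps [[0, 1] x setT] into itself, so relative
     neighbourhoods pull back along [m] to relative neighbourhoods. *)
  move=> C /cF /cm mC; apply: (@filterS _ (nbhs (t, p)) _ _ _ _ mC).
  by move=> [s q] /= + [sI _]; apply.
- by rewrite H0; apply/funext => p; exact: mirrorK.
- by move=> t /hH; exact: homeomorphism_mirror_conj.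
- rewrite !image_comp; congr image; apply/funext => p /=.
  by rewrite mirrorK.
Qed.

Lemma knot_parametrization_mirror (k : R -> space3 R) :
  knot_parametrization k -> knot_parametrization (mirror \o k).
Proof.
have injm := inv_inj mirrorK.
move=> [rk injk]; split; last by move=> s t sI tI /injm; exact: injk.
apply: regular_closed_curve_linear_comp rk => //.
exact: mirror_continuous.
Qed.

(** Reflecting heights preserves the vertical projection, hence the shadow, and reverses every
    comparison of heights at a precrossing. *)
Lemma diagram_of_mirror (S : shadow R) (o : resolution R) (K : set (space3 R)) :
  diagram_of (Diagram S o) K ->
  diagram_of (Diagram S (fun st => ~~ o st)) (mirror @` K).
Proof.
move=> [k [kk kS ko kK]]; exists (mirror \o k); split=> //=.
- exact: knot_parametrization_mirror.
- by move=> st /ko /=; case: (o st); rewrite /= ltrN2.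
- by rewrite -image_comp; exact: ambient_isotopic_mirror.
Qed.

End Mirror.

Lemma necessarily_unknotted_opposite (R : realType) (S : shadow R)
    (P : {fset R * R}) (r : resolution R) :
  necessarily_unknotted S P r ->
  necessarily_unknotted S P (fun st => ~~ r st).
Proof.
move=> Pr o oNr; rewrite -mirror_unknot.
have -> : o = (fun st => ~~ ~~ o st) by apply/funext => st; rewrite negbK.
by apply/diagram_of_mirror/Pr => st /oNr /= ->; rewrite negbK.
Qed.

(** Switching exactly the crossings of [P] where [D] differs from [r] gives a diagram that agrees
    with [r] on [P], hence an unknot. *)
Lemma diagram_unknotting_number_le_disagreement (R : realType) (D : diagram R)
    (P : {fset R * R}) (r : resolution R) :
  [set` P] `<=` precrossings D -> necessarily_unknotted D P r ->
  (diagram_unknotting_number D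
    <= (#|` [fset st in P | over_info D st != r st]%fset|)%:R%:E)%E.
Proof.
move=> PD Pr; apply: ereal_inf_lbound.
exists [fset st in P | over_info D st != r st]%fset => //; split.
  by move=> st /=; rewrite !inE => /andP[/PD].
apply: Pr => st stP; rewrite !inE stP /=.
by case: (over_info D st); case: (r st).
Qed.

Theorem theorem7p3 (R : realType) (K : set (space3 R)) (hK : is_knot K) :
  (unknotting_number K <= trivializing_number K / 2%:E)%E.
Proof.
(* The factor 2 moves to the left, leaving a bare infimum on the right; it then suffices to bound
   twice the unknotting number by the size of each trivializing set [P]. *)
rewrite inver pnatr_eq0 /= lee_pdivlMr //.
apply: le_ereal_inf_tmp => _ [D DK <-].
apply: le_ereal_inf_tmp => _ [P [PD [r Pr]] <-].
have uD : (unknotting_number K <= diagram_unknotting_number D)%E.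
  by apply: ereal_inf_lbound; exists D.
have uA := le_trans uD (diagram_unknotting_number_le_disagreement PD Pr).
have uB := le_trans uD (diagram_unknotting_number_le_disagreement PD
  (necessarily_unknotted_opposite Pr)).
set A := [fset _ in _ | _]%fset in uA.
set B := [fset _ in _ | _]%fset in uB.
(* [D] disagrees with the opposite of [r] exactly where it agrees with [r]. *)
have BE : B = (P `\` A)%fset.
  apply/fsetP => st; rewrite !inE /=; case: (st \in P) => //=.
  by case: (over_info D st); case: (r st).
have AP : (A `<=` P)%fset by apply/fsubsetP => st; rewrite !inE => /andP[].
have <- : (#|` A| + #|` B|)%N = #|` P|.
  by rewrite BE cardfsDS // subnKC // fsubset_leq_card.
rewrite muleC mule_natl mule2n natrD EFinD.
exact: leeD uA uB.
Qed.
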